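(* Suppose $|a|_p=\alpha<\beta$. Put $\tilde\alpha(x)=|f(x)|_p$ for $x\in S_\alpha(0)\setminus\{\hat x_1\}$ and $\tilde\beta(x)=|f(x)|_p$ for $x\in S_\beta(0)\setminus\{\hat x_2\}$. Let $x\in S_r(0)\setminus\mathcal P$. Then the $p$-adic dynamical system generated by $f$ has the following properties. 1. $SI(x_1)=U_\alpha(0)$. 2. If $r>\alpha$ and $r\ne\beta$, then $f(x)\in S_\alpha(0)$. 3. Let $x\in S_\alpha(0)\setminus\mathcal P$. (3.1) If $\tilde\alpha(x)=\alpha$, then $f(x)\in S_\alpha(0)$. (3.2) If $\tilde\alpha(x)>\alpha$ and $\tilde\alpha(x)\neq\beta$, then $f^2(x)\in S_\alpha(0)$. (3.3) If $\tilde\alpha(x)=\beta$, then $f(x)\in S_\beta(0)$. 4. Let $x\in S_\beta(0)\setminus\mathcal P$. (4.1) If $\tilde\beta(x)<\alpha$, then $f^n(x)\in S_{\tilde\beta(x)}(0)$ for all $n\ge1$. (4.2) If $\tilde\beta(x)=\alpha$, then $f(x)\in S_\alpha(0)$. (4.3) If $\tilde\beta(x)>\alpha$ and $\tilde\beta(x)\ne\beta$, then $f^2(x)\in S_\alpha(0)$. (4.4) If $\tilde\beta(x)=\beta$, then $f(x)\in S_\beta(0)$. 5. (5.1) $x_2\in S_\beta(0)$. (5.2) The fixed point $x_2$ is a repeller and the inequality $|f(x)-x_2|_p>|x-x_2|_p$ is satisfied for $x\in U_\beta(x_2)\setminus\mathcal P$, $x\ne x_2$.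
   Context: $p$ is a prime and $\mathbb C_p$ is the field of complex $p$-adic numbers with norm $|\cdot|_p$. Let $a,b,d\in\mathbb C_p$ with $ab\neq0$, $a\ne d$, and $$f(x)=\frac{ax^2+bx}{x^2+dx+b},\qquad x\in\mathbb C_p\setminus\{\hat x_1,\hat x_2\},$$ where $\hat x_1,\hat x_2\in\mathbb C_p$ are the two (possibly equal) roots of $x^2+dx+b$. Put $\alpha=|\hat x_1|_p$, $\beta=|\hat x_2|_p$, labelled so that $\alpha\le\beta$. Standing assumption: $f$ has the two distinct fixed points $x_1=0$ and $x_2=a-d$ (in particular $x_2\notin\{\hat x_1,\hat x_2\}$, i.e. $b+a(a-d)\neq0$). $\mathcal P=\{x\in\mathbb C_p:\exists n\in\mathbb N\cup\{0\},\ f^n(x)\in\{\hat x_1,\hat x_2\}\}$, where $f^n$ is the $n$-th iterate ($f^0=\mathrm{id}$). For $c\in\mathbb C_p$, $r\geq 0$: $U_r(c)=\{x:|x-c|_p<r\}$, $V_r(c)=\{x:|x-c|_p\le r\}$, $S_r(c)=\{x:|x-c|_p=r\}$ (so $S_0(0)=\{0\}$). A fixed point $x_0$ is attractive, indifferent, repeller if $|f'(x_0)|_p<1$, $=1$, $>1$ respectively. A sphere $S$ is invariant if $f$ is defined on $S$ and $f(S)\subset S$. An open ball $U_r(x_0)$ about a fixed point $x_0$ is a Siegel disk if every sphere $S_\rho(x_0)$, $0<\rho<r$, is invariant; $SI(x_0)$ is the union of all Siegel disks centred at $x_0$ (the maximal Siegel disk). *)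

(* Defs.v *)
From mathcomp Require Import all_boot all_order all_algebra.
From mathcomp Require Import boolp classical_sets reals.

Set Implicit Arguments.
Unset Strict Implicit.
Unset Printing Implicit Defensive.

Import Order.TTheory GRing.Theory Num.Theory.
Local Open Scope ring_scope.
Local Open Scope classical_set_scope.

(* The copy of Q_p inside a complete field K extending (Q, |.|_p): the
   topological closure of the prime field. *)
Definition padic_subfield (R : realType) (K : fieldType) (v : K -> R) :
    set K :=
  [set x | forall e : R, 0 < e -> exists q : rat, v (x - ratr q) < e].

Definition algebraic_over_padic (R : realType) (K : fieldType) (v : K -> R) :
    set K :=
  [set x | exists P : {poly K},
     [/\ P != 0, forall i : nat, padic_subfield v P`_i & root P x]].

Definition cauchy_complete (R : realType) (K : fieldType) (v : K -> R) : Prop :=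
  forall u : nat -> K,
    (forall e : R, 0 < e -> exists N : nat, forall m n : nat,
       (N <= m)%N -> (N <= n)%N -> v (u m - u n) < e) ->
    exists l : K, forall e : R, 0 < e -> exists N : nat, forall n : nat,
       (N <= n)%N -> v (u n - l) < e.

(* (K, v) is the field C_p with its norm |.|_p: an algebraically closed field,
   complete for a multiplicative ultrametric norm normalised by |p|_p = 1/p
   (hence restricting to the p-adic norm on Q), in which the algebraic closure
   of Q_p is dense.  This is the completion of an algebraic closure of Q_p, and
   it determines (K, v) up to isometric isomorphism. *)
Record is_Cp (p : nat) (R : realType) (K : closedFieldType) (v : K -> R) :
    Prop := IsCp {
  Cp_norm_ge0 : forall x, 0 <= v x;
  Cp_norm_eq0 : forall x, v x = 0 <-> x = 0;
  Cp_normM : forall x y, v (x * y) = v x * v y;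
  Cp_norm_ultra : forall x y, v (x + y) <= Num.max (v x) (v y);
  Cp_norm_p : v p%:R = p%:R^-1;
  Cp_complete : cauchy_complete v;
  Cp_dense : forall (x : K) (e : R), 0 < e ->
    exists2 y, algebraic_over_padic v y & v (x - y) < e
}.

Definition oball (R : realType) (K : fieldType) (v : K -> R) (r : R) (c : K) :
  set K := [set x | v (x - c) < r].

Definition sphere (R : realType) (K : fieldType) (v : K -> R) (r : R) (c : K) :
  set K := [set x | v (x - c) = r].

(* Division by 0 yields 0, so this is a total function; it is the intended one
   off the roots of x^2 + d x + b.  The notions below take the set E of points
   where f is undefined and never depend on the values of f on E. *)
Definition ratmap (K : fieldType) (a b d x : K) : K :=
  (a * x ^+ 2 + b * x) / (x ^+ 2 + d * x + b).

Definition pole_orbits (K : fieldType) (E : set K) (f : K -> K) : set K :=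
  [set x | exists n : nat, E (iter n f x)].

Definition fixed_point (K : fieldType) (E : set K) (f : K -> K) (x0 : K) :
  Prop := ~ E x0 /\ f x0 = x0.

Definition has_derivative (R : realType) (K : fieldType) (v : K -> R)
    (E : set K) (f : K -> K) (x0 l : K) : Prop :=
  forall e : R, 0 < e -> exists2 delta : R, 0 < delta &
    forall y, ~ E y -> y != x0 -> v (y - x0) < delta ->
      v ((f y - f x0) / (y - x0) - l) < e.

Definition repeller (R : realType) (K : fieldType) (v : K -> R)
    (E : set K) (f : K -> K) (x0 : K) : Prop :=
  fixed_point E f x0 /\
  exists2 l : K, has_derivative v E f x0 l & 1 < v l.

Definition invariant_set (K : fieldType) (E : set K) (f : K -> K) (S : set K) :
  Prop := S `<=` ~` E /\ f @` S `<=` S.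

Definition siegel_disk (R : realType) (K : fieldType) (v : K -> R)
    (E : set K) (f : K -> K) (x0 : K) (D : set K) : Prop :=
  fixed_point E f x0 /\
  exists r : R, [/\ 0 < r, D = oball v r x0 &
    forall rho : R, 0 < rho -> rho < r ->
      invariant_set E f (sphere v rho x0)].

Definition SI (R : realType) (K : fieldType) (v : K -> R)
    (E : set K) (f : K -> K) (x0 : K) : set K :=
  \bigcup_(D in [set D | siegel_disk v E f x0 D]) D.

(* Main.v *)
Require Import Defs.
From mathcomp Require Import all_boot all_order all_algebra.
From mathcomp Require Import boolp classical_sets reals.
From mathcomp Require Import ring.

Set Implicit Arguments.
Unset Strict Implicit.
Unset Printing Implicit Defensive.

Import Order.TTheory GRing.Theory Num.Theory.
Local Open Scope ring_scope.
Local Open Scope classical_set_scope.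

(** Writing [Q = (x - xh1) (x - xh2)] for the denominator, one has
    [|d| = beta] and [|b| = alpha * beta], so off the spheres of radius [alpha]
    and [beta] the strong triangle inequality determines [|f x|] from [|x|]:
    it is [|x|] when [|x| < alpha], and [alpha] otherwise.  The disk
    [U_alpha(0)] is maximal because the pole [xh1] lies on its boundary sphere.
    Near [x2] one uses [f x - x2 = (x - x2) (d x + b) / Q]: if
    [|x - x2| < beta] then [|d x + b| = beta ^ 2] and
    [|Q| = beta * |x - xh2|], where [|x - xh2| < beta] because
    [x2 - xh2 = a + xh1] has norm at most [alpha]. *)

(** * Consequences of the strong triangle inequality *)

Section UltrametricNorm.
Variables (p : nat) (R : realType) (K : closedFieldType) (v : K -> R).
Hypothesis KP : is_Cp p v.

Lemma Cp_norm0 : v 0 = 0.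
Proof. exact/(Cp_norm_eq0 KP). Qed.

Lemma Cp_norm_gt0 x : (0 < v x) = (x != 0).
Proof.
rewrite lt_def (Cp_norm_ge0 KP) andbT; congr (~~ _).
by apply/eqP/eqP => /(Cp_norm_eq0 KP).
Qed.

Lemma Cp_normN x : v (- x) = v x.
Proof.
have : v (- x) ^+ 2 = v x ^+ 2 by rewrite !expr2 -!(Cp_normM KP) mulrNN.
by move/eqP; rewrite eqrXn2 ?(Cp_norm_ge0 KP) // => /eqP.
Qed.

Lemma Cp_norm_div x y : y != 0 -> v (x / y) = v x / v y.
Proof.
move=> y_neq0; apply: (@mulIf _ (v y)); first by rewrite gt_eqF ?Cp_norm_gt0.
by rewrite -(Cp_normM KP) !divfK // gt_eqF ?Cp_norm_gt0.
Qed.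

Lemma Cp_normD_le x y r : v x <= r -> v y <= r -> v (x + y) <= r.
Proof.
by move=> xr yr; apply: le_trans (Cp_norm_ultra KP x y) _; rewrite ge_max xr.
Qed.

Lemma Cp_normD_lt x y r : v x < r -> v y < r -> v (x + y) < r.
Proof.
by move=> xr yr; apply: le_lt_trans (Cp_norm_ultra KP x y) _; rewrite gt_max xr.
Qed.

(** The dominant term decides: if [x + y] had smaller norm than [x], then so would
    [x = (x + y) - y]. *)
Lemma Cp_normDl x y : v y < v x -> v (x + y) = v x.
Proof.
move=> yx; apply/eqP; rewrite eq_le Cp_normD_le ?(ltW yx) //= leNgt.
apply/negP => xyx; suff: v (x + y - y) < v x by rewrite addrK ltxx.
by rewrite Cp_normD_lt ?Cp_normN.
Qed.

Lemma Cp_normDr x y : v x < v y -> v (x + y) = v y.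
Proof. by rewrite addrC; apply: Cp_normDl. Qed.

End UltrametricNorm.

Section RationalMap.
Variables (p : nat) (R : realType) (Cp : closedFieldType) (v : Cp -> R).
Hypothesis CpP : is_Cp p v.
Variables (a b d xh1 xh2 : Cp).
Hypothesis a_neq0 : a != 0.
Hypothesis b_neq0 : b != 0.
Hypothesis roots : 'X^2 + d *: 'X + b%:P = ('X - xh1%:P) * ('X - xh2%:P).
Hypothesis x2_not_pole : b + a * (a - d) != 0.
Hypothesis a_xh1 : v a = v xh1.
Hypothesis xh1_lt_xh2 : v xh1 < v xh2.

Local Notation f := (ratmap a b d).
Local Notation E := ([set xh1; xh2] : set Cp).
Local Notation alpha := (v xh1).
Local Notation beta := (v xh2).
Local Notation x2 := (a - d).

(** * Coefficients and poles in terms of the roots *)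

Lemma denominator_factor x : x ^+ 2 + d * x + b = (x - xh1) * (x - xh2).
Proof. by have /(congr1 (horner^~ x)) := roots; rewrite !hornerE. Qed.

Lemma constant_coefE : b = xh1 * xh2.
Proof.
by have := denominator_factor 0; rewrite expr0n mulr0 !add0r mulrNN.
Qed.

Lemma linear_coefE : d = - (xh1 + xh2).
Proof.
(* Evaluating the denominator at 1 isolates [d], since [b] is already known. *)
have -> : d = (1 ^+ 2 + d * 1 + b) - 1 - b by ring.
by rewrite denominator_factor constant_coefE; ring.
Qed.

Lemma alpha_gt0 : 0 < alpha.
Proof. by rewrite -a_xh1 (Cp_norm_gt0 CpP). Qed.

Lemma beta_gt0 : 0 < beta.
Proof. exact: lt_trans alpha_gt0 xh1_lt_xh2. Qed.

Lemma norm_b : v b = alpha * beta.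
Proof. by rewrite constant_coefE (Cp_normM CpP). Qed.

Lemma norm_d : v d = beta.
Proof. by rewrite linear_coefE (Cp_normN CpP) (Cp_normDr CpP). Qed.

Lemma denominator_eq0 x : (x ^+ 2 + d * x + b == 0) = (x == xh1) || (x == xh2).
Proof. by rewrite denominator_factor mulf_eq0 !subr_eq0. Qed.

Lemma not_poleP x : ~ E x <-> x ^+ 2 + d * x + b != 0.
Proof.
rewrite denominator_eq0; split.
- by move=> nE; apply/norP; split; apply/eqP => h; apply: nE; [left|right].
- by move=> /norP[/eqP n1 /eqP n2] [].
Qed.

Lemma norm_not_pole x : v x != alpha -> v x != beta -> ~ E x.
Proof. by move=> na nb [h|h]; move: na nb; rewrite h eqxx. Qed.

(** * Norm of the image off the two spheres through the poles *)

Lemma norm_ratmap x : ~ E x ->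
  v (f x) = v x * v (a * x + b) / (v (x - xh1) * v (x - xh2)).
Proof.
move=> /not_poleP Qx; rewrite /ratmap (Cp_norm_div CpP) //.
rewrite denominator_factor -!(Cp_normM CpP); congr (v _ / _); ring.
Qed.

(** Here [b] dominates [a * x] and each root dominates [x], so the quotient is
    [v x * (alpha * beta) / (alpha * beta)]. *)
Lemma norm_ratmap_lt x : v x < alpha -> v (f x) = v x.
Proof.
move=> xa; have xb := lt_trans xa xh1_lt_xh2.
have a0 := alpha_gt0; have b0 := beta_gt0.
rewrite norm_ratmap; last by apply: norm_not_pole; rewrite lt_eqF.
rewrite (Cp_normDr CpP (y := b)) ?norm_b ?(Cp_normM CpP) ?a_xh1 ?ltr_pM2l //.
rewrite !(Cp_normDr CpP (x := x)) ?(Cp_normN CpP) // mulfK // mulf_neq0 // gt_eqF //.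
Qed.

(** The factor [x - xh1] always has norm [v x]. Below [beta], the terms [b] and [xh2] dominate;
    above it, [a * x] and [x] do. Both quotients reduce to [alpha]. *)
Lemma norm_ratmap_gt x : alpha < v x -> v x != beta -> v (f x) = alpha.
Proof.
move=> ax xb; have a0 := alpha_gt0; have b0 := beta_gt0.
have x0 := lt_trans a0 ax.
rewrite norm_ratmap; last by apply: norm_not_pole; rewrite // gt_eqF.
rewrite (Cp_normDl CpP (x := x) (y := - xh1)) ?(Cp_normN CpP) //.
case: (ltgtP (v x) beta) xb => // xb _.
- rewrite (Cp_normDr CpP (y := b)) ?norm_b ?(Cp_normM CpP) ?a_xh1 ?ltr_pM2l //.
  rewrite (Cp_normDr CpP (x := x)) ?(Cp_normN CpP) //.
  by field; rewrite !gt_eqF.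
- rewrite (Cp_normDl CpP (y := b)) ?norm_b ?(Cp_normM CpP) ?a_xh1 ?ltr_pM2l //.
  rewrite (Cp_normDl CpP (x := x)) ?(Cp_normN CpP) //.
  by field; rewrite gt_eqF.
Qed.

Lemma norm_iter_ratmap_lt x n : v x < alpha -> v (iter n f x) = v x.
Proof. by move=> xa; elim: n => //= n IH; rewrite norm_ratmap_lt IH. Qed.

(** * The maximal Siegel disk at 0 *)

Lemma SI_ratmap0 : SI v E f 0 = oball v alpha 0.
Proof.
apply/seteqP; split=> x.
- move=> [D [_ [r [_ -> Sinv]]]]; rewrite /oball /= subr0 => xr.
  (* Otherwise the radius [r] exceeds [alpha], so the sphere of radius [alpha] would be invariant
     although it contains [xh1]. *)
  case: (ltP (v x) alpha) => // ax.
  have [SE _] := Sinv alpha alpha_gt0 (le_lt_trans ax xr).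
  by case: (SE xh1); [rewrite /sphere /= subr0 | left].
- move=> xa; exists (oball v alpha 0) => //; split.
  + split; last by rewrite /ratmap expr0n !mulr0 addr0 mul0r.
    by apply/not_poleP; rewrite expr0n mulr0 !add0r.
  + exists alpha; split=> //; first exact: alpha_gt0.
    move=> rho rho0 rhoa; split=> [y|_ [y + <-]]; rewrite /sphere /= !subr0.
    * move=> yr; apply: norm_not_pole; rewrite yr lt_eqF //.
      exact: lt_trans rhoa xh1_lt_xh2.
    * by move=> yr; rewrite norm_ratmap_lt yr.
Qed.

(** * The repelling fixed point [x2] *)

Lemma norm_x2 : v x2 = beta.
Proof. by rewrite (Cp_normDr CpP) (Cp_normN CpP) norm_d ?a_xh1. Qed.

Lemma x2_notin_poles : ~ E x2.
Proof.
apply/not_poleP; rewrite (_ : _ + b = b + a * (a - d)) //; ring.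
Qed.

(** The second factor is the difference quotient of [f] at [x2]: its norm measures the expansion,
    and its value at [x2] is the derivative. *)
Lemma ratmap_sub_x2 x : ~ E x ->
  f x - x2 = (x - x2) * ((d * x + b) / (x ^+ 2 + d * x + b)).
Proof. by move=> /not_poleP Qx; rewrite /ratmap; field. Qed.

Lemma ratmap_x2 : f x2 = x2.
Proof.
apply/eqP; rewrite -subr_eq0 ratmap_sub_x2; last exact: x2_notin_poles.
by rewrite subrr mul0r.
Qed.

Lemma norm_near_x2 x : v (x - x2) < beta -> v x = beta.
Proof.
by move=> xb; rewrite -[x](subrK x2) (Cp_normDr CpP) norm_x2.
Qed.

Lemma norm_sub_xh2_lt x : v (x - x2) < beta -> v (x - xh2) < beta.
Proof.
move=> xb; rewrite (_ : x - xh2 = (x - x2) + (a + xh1)); last first.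
  by rewrite linear_coefE; ring.
rewrite (Cp_normD_lt CpP) // (le_lt_trans _ xh1_lt_xh2) //.
by rewrite (Cp_normD_le CpP) ?a_xh1.
Qed.

(** The term [d * x] dominates, because [v b = alpha * beta < beta ^+ 2]. *)
Lemma norm_slope_num x : v x = beta -> v (d * x + b) = beta ^+ 2.
Proof.
move=> xb; have b0 := beta_gt0.
have dx : v (d * x) = beta ^+ 2 by rewrite (Cp_normM CpP) norm_d xb.
by rewrite (Cp_normDl CpP) dx // norm_b expr2 ltr_pM2r.
Qed.

Lemma norm_denominator x : v x = beta ->
  v (x ^+ 2 + d * x + b) = beta * v (x - xh2).
Proof.
move=> xb; rewrite denominator_factor (Cp_normM CpP); congr (_ * _).
by rewrite (Cp_normDl CpP) ?(Cp_normN CpP) xb.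
Qed.

(** The norm of the slope is [beta / v (x - xh2)], whose denominator is positive off the poles and
    less than [beta]. *)
Lemma norm_slope_gt1 x : v (x - x2) < beta -> ~ E x ->
  1 < v ((d * x + b) / (x ^+ 2 + d * x + b)).
Proof.
move=> xb nE; have b0 := beta_gt0; have vx := norm_near_x2 xb.
have /not_poleP Qx := nE.
have m0 : 0 < v (x - xh2).
  by rewrite (Cp_norm_gt0 CpP) subr_eq0; apply/eqP => h; apply: nE; right.
rewrite (Cp_norm_div CpP) // norm_slope_num // norm_denominator //.
rewrite ltr_pdivlMr ?mulr_gt0 // mul1r expr2 ltr_pM2l //.
exact: norm_sub_xh2_lt.
Qed.

Lemma x2_has_derivative :
  has_derivative v E f x2 ((d * x2 + b) / (x2 ^+ 2 + d * x2 + b)).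
Proof.
have b0 := beta_gt0; have x2E := x2_notin_poles.
have /not_poleP Q2 := x2E; have vx2 := norm_x2.
have m0 : 0 < v (x2 - xh2).
  by rewrite (Cp_norm_gt0 CpP) subr_eq0; apply/eqP => h; apply: x2E; right.
have mb : v (x2 - xh2) < beta.
  by apply: norm_sub_xh2_lt; rewrite subrr (Cp_norm0 CpP).
set m := v (x2 - xh2) in m0 mb.
(* The bound [m] keeps [y] at distance exactly [m] from [xh2], so both denominators have norm
   [beta * m]. The slopes at [y] and [x2] then differ by at most
   [v (y - x2) * beta ^+ 3 / (beta * m) ^+ 2], which the second bound makes less than [e]. *)
move=> e e0; exists (Num.min m (e * m ^+ 2 / beta)).
  by rewrite lt_min m0 !(mulr_gt0, invr_gt0, exprn_gt0).
move=> y yE yx2; rewrite lt_min => /andP[ym ye].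
have /not_poleP Qy := yE.
have vy : v y = beta by apply: norm_near_x2; apply: lt_trans ym mb.
have vyh : v (y - xh2) = m.
  by rewrite -[y](subrK x2) -addrA (Cp_normDr CpP).
rewrite ratmap_x2 ratmap_sub_x2 // mulrAC divff ?subr_eq0 // mul1r.
set qy := y ^+ 2 + d * y + b; set q2 := x2 ^+ 2 + d * x2 + b.
have vqy : v qy = beta * m by rewrite norm_denominator // vyh.
have vq2 : v q2 = beta * m by rewrite norm_denominator.
(* The factor [y - x2] comes out because [qy - q2 = (y - x2) * (y + x2 + d)]. *)
have -> : (d * y + b) / qy - (d * x2 + b) / q2 =
    (y - x2) * (d * q2 - (d * x2 + b) * (y + x2 + d)) / (qy * q2).
  by rewrite /qy /q2; field; rewrite Q2 Qy.
rewrite (Cp_norm_div CpP) ?mulf_neq0 // !(Cp_normM CpP) vqy vq2.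
have num_le : v (d * q2 - (d * x2 + b) * (y + x2 + d)) <= beta ^+ 3.
  apply: (Cp_normD_le CpP); rewrite ?(Cp_normN CpP) (Cp_normM CpP).
    by rewrite norm_d vq2 (exprS _ 2) ler_pM2l // expr2 ler_pM2l // ltW.
  rewrite norm_slope_num // (exprSr _ 2) ler_pM2l ?exprn_gt0 //.
  by apply: (Cp_normD_le CpP); rewrite ?norm_d // (Cp_normD_le CpP) ?vy ?vx2.
rewrite ltr_pdivrMr ?mulr_gt0 //.
apply: le_lt_trans (ler_wpM2l (Cp_norm_ge0 CpP _) num_le) _.
rewrite ltr_pdivlMr // in ye.
have -> : e * (beta * m * (beta * m)) = e * m ^+ 2 * beta ^+ 2 by ring.
by rewrite (exprS _ 2) mulrA ltr_pM2r ?exprn_gt0.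
Qed.

Lemma x2_repeller : repeller v E f x2.
Proof.
have nE := x2_notin_poles; split; first by split=> //; exact: ratmap_x2.
eexists; first exact: x2_has_derivative.
by apply: norm_slope_gt1 => //; rewrite subrr (Cp_norm0 CpP) beta_gt0.
Qed.

Lemma ratmap_expands_near_x2 x : v (x - x2) < beta -> ~ E x -> x != x2 ->
  v (x - x2) < v (f x - x2).
Proof.
move=> xb nE xx2; rewrite ratmap_sub_x2 // (Cp_normM CpP).
by rewrite ltr_pMr ?norm_slope_gt1 // (Cp_norm_gt0 CpP) subr_eq0.
Qed.

End RationalMap.

Theorem theorem6 (p : nat) (p_prime : prime p) (R : realType)
    (Cp : closedFieldType) (v : Cp -> R) (CpP : is_Cp p v)
    (a b d xh1 xh2 : Cp) (alpha beta : R)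
    (ab_neq0 : a * b != 0) (a_neq_d : a != d)
    (roots : 'X^2 + d *: 'X + b%:P = ('X - xh1%:P) * ('X - xh2%:P))
    (x2_not_pole : b + a * (a - d) != 0)
    (alphaE : alpha = v xh1) (betaE : beta = v xh2)
    (a_alpha : v a = alpha) (alpha_lt_beta : alpha < beta) :
  let f := ratmap a b d in
  let E := [set xh1; xh2] in
  let P := pole_orbits E f in
  let x1 := 0 in
  let x2 := a - d in
  let S := fun r : R => sphere v r 0 in
  (* 1 *)
  SI v E f x1 = oball v alpha 0 /\
  (* 2 *)
  (forall (r : R) (x : Cp), (S r `\` P) x ->
     alpha < r -> r != beta -> S alpha (f x)) /\
  (* 3 *)
  (forall x : Cp, (S alpha `\` P) x ->
     [/\ v (f x) = alpha -> S alpha (f x),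
         alpha < v (f x) -> v (f x) != beta -> S alpha (iter 2 f x)
       & v (f x) = beta -> S beta (f x)]) /\
  (* 4 *)
  (forall x : Cp, (S beta `\` P) x ->
     [/\ v (f x) < alpha ->
           forall n : nat, (1 <= n)%N -> S (v (f x)) (iter n f x),
         v (f x) = alpha -> S alpha (f x),
         alpha < v (f x) -> v (f x) != beta -> S alpha (iter 2 f x)
       & v (f x) = beta -> S beta (f x)]) /\
  (* 5 *)
  [/\ S beta x2, repeller v E f x2
    & forall x : Cp, (oball v beta x2 `\` P) x -> x != x2 ->
        v (x - x2) < v (f x - x2)].
Proof.
subst alpha beta; move: ab_neq0; rewrite mulf_eq0 => /norP[a0 b0] f E P x1 x2 S.
(* Applied to [x] this gives assertion 2; applied to [f x] it gives both claims about the second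
   iterate. *)
have Sgt x : v xh1 < v x -> v x != v xh2 -> S (v xh1) (f x).
  by move=> ax xb; rewrite /S /sphere /= subr0; apply: (norm_ratmap_gt CpP a0 roots).
have SvE x : S (v x) x by rewrite /S /sphere /= subr0.
have SE r x : v x = r -> S r x by move=> <-.
split; first exact: (SI_ratmap0 CpP a0 b0 roots).
split.
  by move=> r x []; rewrite {1}/S /sphere /= subr0 => <- _; apply: Sgt.
split; first by move=> x _; split=> [/SE//| /= |/SE//]; apply: Sgt.
split.
  move=> x _; split=> [fx [//|n] _|/SE//| /= |/SE//]; last exact: Sgt.
  (* Only [f x] is known to have norm below [alpha], so one application is moved innermost and the
     other [n] preserve its norm. *)
  by apply: SE; rewrite iterSr; apply: (norm_iter_ratmap_lt CpP a0 roots).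
split.
- by apply: SE; apply: (norm_x2 CpP roots).
- exact: (x2_repeller CpP a0 roots).
- move=> x [xb xP]; apply: (ratmap_expands_near_x2 CpP a0 roots) => // Ex.
  (* A pole lies in [P] through its zeroth iterate. *)
  by apply: xP; exists 0%N.
Qed.
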